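(* Let $L>0$, $\beta\in(0,1]$, $\alpha>0$ and $C\ge1$. There is a constant $c_\ell>0$, independent of $n,n_P,n_Q,\sigma^2$ (it may depend on $L,\beta,\alpha,C$), and, for every $\sigma>0$, an integer $n_\ell=n_\ell(\sigma,L,C,\alpha,\beta)$ such that for all nonnegative integers $n_P,n_Q$ with $\max\{n_P,n_Q\}\ge n_\ell$: (a) If $\alpha>1$, there is a pair of distributions $(P,Q)\in\mathcal{D}(\alpha,C)$ such that $$\inf_{\hat f}\sup_{f^\star\in\mathcal{F}(\beta,L)}\mathbf{E}\|\hat f-f^\star\|_{L^2(Q)}^2\ \ge\ c_\ell\Big\{\Big(\frac{n_P}{\sigma^2}\Big)^{\frac{2\beta+1}{2\beta+\alpha}}+\frac{n_Q}{\sigma^2}\Big\}^{-\frac{2\beta}{2\beta+1}}.$$ (b) If $\alpha\le1$, there is a pair of distributions $(P,Q)\in\mathcal{D}'(\alpha,C)$ such that $$\inf_{\hat f}\sup_{f^\star\in\mathcal{F}(\beta,L)}\mathbf{E}\|\hat f-f^\star\|_{L^2(Q)}^2\ \ge\ c_\ell\Big\{\Big(\frac{n_P}{\sigma^2}\Big)^{\frac{2\beta}{2\beta+\alpha}}+\frac{n_Q}{\sigma^2}\Big\}^{-1}.$$ Here, in both parts, the supremum is taken over $f^\star\in\mathcal{F}(\beta,L)$ and also over all noise distributions admissible at level $\sigma$ in the observation model described in the context.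
   Context: The covariate space is $\mathcal{X}=[0,1]$ with metric $|x-x'|$; $P,Q$ denote Borel probability measures on $[0,1]$; $\mathsf{B}(x,h)=\{x'\in[0,1]:|x-x'|\le h\}$. Similarity measure: $\rho_h(P,Q)=\int_{[0,1]}\frac{1}{P(\mathsf{B}(x,h))}\,dQ(x)$ for $h>0$ (with $1/0=+\infty$). For $\alpha\ge1$, $C\ge 1$: $\mathcal{D}(\alpha,C)=\{(P,Q):\ \sup_{0<h\le1}h^\alpha\rho_h(P,Q)\le C\}$. For $\alpha\in(0,1]$, $C\ge 1$: $\mathcal{D}'(\alpha,C)=\{(P,Q):\ \sup_{0<h\le1}h^\alpha\rho_h(P,Q)\le C\ \text{ and }\ \sup_{0<h\le1}\rho_h(Q,Q)\le C\}$. Function class: $\mathcal{F}(\beta,L)=\{f:[0,1]\to\mathbb{R}:\ |f(x)-f(x')|\le L|x-x'|^\beta\ \text{for all }x,x'\in[0,1],\ f(0)=0\}$. Observation model: $n=n_P+n_Q$; $(X_i,Y_i)_{i=1}^n$ are independent pairs with $X_1,\dots,X_{n_P}\sim P$, $X_{n_P+1},\dots,X_{n}\sim Q$, and $Y_i=f^\star(X_i)+\xi_i$, where the conditional law of $\xi_i$ given $X_i$ is the same for all $i$. The noise distribution is admissible at level $\sigma$ if $\mathbf{E}[\xi_i\mid X_i=x]=0$ and $\mathbf{E}[\xi_i^2\mid X_i=x]\le\sigma^2$ for all $x$. The infimum is over all estimators $\hat f$, i.e. measurable functions of the data $(X_i,Y_i)_{i=1}^n$ (which may depend on $P,Q,n_P,n_Q$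 and the parameters); the expectation is over the data, and $\|g\|_{L^2(Q)}^2=\int g^2\,dQ$. *)

(* Defs.v *)
From HB Require Import structures.
From mathcomp Require Import all_boot all_order all_algebra.
From mathcomp Require Import all_classical all_reals all_analysis.

Set Implicit Arguments.
Unset Strict Implicit.
Unset Printing Implicit Defensive.

Import Order.TTheory GRing.Theory Num.Theory.
Import numFieldNormedType.Exports.

Local Open Scope classical_set_scope.
Local Open Scope ring_scope.

(* Objects living on the covariate space [0,1] are represented on R: a
   probability measure on [0,1] is a probability measure on R giving mass 1 to
   [0,1], and only the restriction to [0,1] of a regression function, of a noise
   kernel or of an estimated function is ever used. *)

Definition unit_itv (R : realType) : set R := `[0%R, 1%R].

Section Similarity.
Variable R : realType.
Implicit Types P Q : probability (measurableTypeR R) R.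

Definition unit_ball (x h : R) : set R :=
  [set x' | unit_itv x' /\ `|x - x'| <= h].

(* The inverse is the one of the extended reals, for which 0^-1 = +oo. *)
Definition similarity (h : R) P Q : \bar R :=
  (\int[Q]_(x in @unit_itv R) (P (unit_ball x h))^-1)%E.

Definition class_D (alpha C : R) P Q : Prop :=
  [/\ P (@unit_itv R) = 1%E, Q (@unit_itv R) = 1%E &
      (ereal_sup [set (h `^ alpha)%:E * similarity h P Q
                 | h in [set h : R | 0 < h <= 1]%R] <= C%:E)%E].

Definition class_D' (alpha C : R) P Q : Prop :=
  class_D alpha C P Q /\
  (ereal_sup [set similarity h Q Q | h in [set h : R | 0 < h <= 1]%R]
     <= C%:E)%E.

End Similarity.

Definition hoelder_class (R : realType) (beta L : R) (f : R -> R) : Prop :=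
  (forall x x' : R, unit_itv x -> unit_itv x' ->
     `|f x - f x'| <= L * `|x - x'| `^ beta) /\
  f 0 = 0.

(* The kernel kappa is the conditional law of the noise given the covariate.
   The second moment bound makes the first moment absolutely convergent. *)
Definition admissible_noise (R : realType) (sigma : R)
    (kappa : R.-pker (measurableTypeR R) ~> (measurableTypeR R)) : Prop :=
  forall x : R, unit_itv x ->
    (\int[kappa x]_e e%:E = 0)%E /\
    (\int[kappa x]_e (e ^+ 2)%:E <= (sigma ^+ 2)%:E)%E.

Section ObservationModel.
Variables (R : realType) (d : measure_display) (Omega : measurableType d).
Variable Pr : probability Omega R.

Definition mutually_independent n
    (Z : 'I_n -> Omega -> measurableTypeR R * measurableTypeR R) : Prop :=
  forall (J : {set 'I_n})
    (A : 'I_n -> set (measurableTypeR R * measurableTypeR R)),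
    (forall i, measurable (A i)) ->
    (Pr (\bigcap_(i in [set` J]) (Z i @^-1` A i)) =
     \prod_(i in J) Pr (Z i @^-1` A i))%E.

Definition response n (f : R -> R) (X xi : 'I_n -> Omega -> R)
  (i : 'I_n) (w : Omega) : R := f (X i w) + xi i w.

Definition sample n (X Y : 'I_n -> Omega -> R) (w : Omega) :
    n.-tuple (measurableTypeR R * measurableTypeR R) :=
  [tuple (X i w, Y i w) | i < n].

Definition observation_model (nP nQ : nat)
    (P Q : probability (measurableTypeR R) R) (f : R -> R)
    (kappa : R.-pker (measurableTypeR R) ~> (measurableTypeR R))
    (X xi : 'I_(nP + nQ) -> {RV Pr >-> measurableTypeR R}) : Prop :=
  [/\ forall i w, unit_itv (X i w),
      forall i A, measurable A ->
        Pr (X i @^-1` A) = if (i < nP)%N then P A else Q A,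
      forall i A B, measurable A -> measurable B ->
        Pr (X i @^-1` A `&` xi i @^-1` B) =
        (\int[Pr]_(w in X i @^-1` A) kappa (X i w) B)%E &
      mutually_independent (fun i w => (X i w, response f X xi i w))].

End ObservationModel.

Section MinimaxRisk.
Variable R : realType.

(* An estimator maps the data to a function on [0,1]; measurability is joint in
   the data and in the evaluation point, so that the L^2(Q) loss is measurable
   in the data. *)
Definition estimator n
    (fhat : n.-tuple (measurableTypeR R * measurableTypeR R) -> R -> R) :
    Prop :=
  measurable_fun
    ([set: n.-tuple (measurableTypeR R * measurableTypeR R)]
       `*` (@unit_itv R : set (measurableTypeR R)))
    (fun z => fhat z.1 z.2 : measurableTypeR R).

Definition sq_loss (Q : probability (measurableTypeR R) R) (g f : R -> R) :
    \bar R :=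
  (\int[Q]_(x in @unit_itv R) ((g x - f x) ^+ 2)%:E)%E.

(* The expected loss depends on the underlying probability space only through
   the law of the data, hence only on f and kappa; ranging over all the
   realizations of the model does not change the supremum. *)
Definition worst_case_risk (beta L sigma : R) (nP nQ : nat)
    (P Q : probability (measurableTypeR R) R)
    (fhat : (nP + nQ).-tuple (measurableTypeR R * measurableTypeR R) -> R -> R) :
    \bar R :=
  ereal_sup [set r : \bar R | exists (f : R -> R)
    (kappa : R.-pker (measurableTypeR R) ~> (measurableTypeR R))
    (d : measure_display) (Omega : measurableType d) (Pr : probability Omega R)
    (X xi : 'I_(nP + nQ) -> {RV Pr >-> measurableTypeR R}),
    [/\ hoelder_class beta L f, admissible_noise sigma kappa,
        observation_model P Q f kappa X xi &
        r = (\int[Pr]_w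
               sq_loss Q (fhat (sample X (response f X xi) w)) f)%E]].

Definition minimax_risk (beta L sigma : R) (nP nQ : nat)
    (P Q : probability (measurableTypeR R) R) : \bar R :=
  ereal_inf [set worst_case_risk beta L sigma P Q fhat
            | fhat in @estimator (nP + nQ)].

End MinimaxRisk.

(* Main.v *)
(* Everything happens on a finite design. For a bandwidth h take M cells, the
   j-th one made of a centre (2j+1)h and of a zero 2jh; Q is uniform on the
   centres, P puts mass h^alpha on each centre and the rest of its mass, evenly,
   on the zeros. The regression functions are f_th = max_j th_j K (h^beta -
   |x - x_j|^beta)^+, th ranging over the cube {0,1}^M, and the noise is chosen
   so that the response is +sigma or -sigma with probability
   (1 +- f_th(x)/sigma)/2. Assouad's argument reduces the risk to M two-point
   problems; the chi-square divergence of each of them is controlled by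
   (n_P h^alpha + n_Q/M) (K h^beta/sigma)^2, which the choice of h keeps bounded.
   If alpha > 1 there are M ~ 1/(3h) cells: Q charges a set of macroscopic
   extent, and the balls around the centres have P-mass at least r >= r^alpha as
   soon as r >= h. If alpha <= 1 a single cell is enough, Q being a Dirac mass. *)

Require Import Defs.
From HB Require Import structures.
From mathcomp Require Import all_boot all_order all_algebra.
From mathcomp Require Import all_classical all_reals all_analysis.
From mathcomp Require Import measurable_realfun ring lra zify.
Set Implicit Arguments.
Unset Strict Implicit.
Unset Printing Implicit Defensive.
Import Order.TTheory GRing.Theory Num.Theory.
Import numFieldNormedType.Exports.
Local Open Scope classical_set_scope.
Local Open Scope ring_scope.

(** * Finitely supported probability measures *)

Section FiniteProbability.
Context d (T : measurableType d) (R : realType) (I : finType).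
Variables (w : I -> R) (y : I -> T).
Hypothesis w_ge0 : forall i, 0 <= w i.

(** [msum] adds up a sequence of measures, so the atoms are numbered through [enum_val]; numbers
    from [#|I|] on get the null measure. *)
Let atom (k : nat) : {measure set T -> \bar R} :=
  if insub k is Some i then
    mscale (NngNum (w_ge0 (enum_val (i : 'I_#|I|)))) \d_(y (enum_val i))
  else mzero.

Definition fin_meas : set T -> \bar R := msum atom #|I|.

HB.instance Definition _ := Measure.on fin_meas.

Lemma fin_measE A : fin_meas A = (\sum_i w i * \1_A (y i))%:E.
Proof.
rewrite /fin_meas /msum -sumEFin (reindex (@enum_val I I)) /=; last first.
  exact/onW_bij/enum_val_bij.
by apply: eq_bigr => i _; rewrite /atom valK /= /mscale/= diracE indicE EFinM.
Qed.

Hypothesis w_sum1 : \sum_i w i = 1.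

(** Normalisation is an argument, so that the probability structure declared next can be inferred
    from the term. *)
Definition fin_prob of (\sum_i w i = 1) := fin_meas.

HB.instance Definition _ := Measure.on (fin_prob w_sum1).

Let fin_probT : fin_prob w_sum1 setT = 1%E.
Proof.
rewrite /fin_prob fin_measE -w_sum1; congr EFin.
by apply: eq_bigr => i _; rewrite indicT mulr1.
Qed.

HB.instance Definition _ :=
  Measure_isProbability.Build _ _ _ (fin_prob w_sum1) fin_probT.

Let P : probability T R := fin_prob w_sum1.

Lemma fin_probE A : P A = (\sum_i w i * \1_A (y i))%:E.
Proof. exact: fin_measE. Qed.

Let ge0_integral_fin_prob_measurable (g : T -> \bar R) :
  (forall x, 0 <= g x)%E -> measurable_fun setT g ->
  (\int[P]_x g x = \sum_i (w i)%:E * g (y i))%E.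
Proof.
move=> g0 mg.
transitivity (\int[msum atom #|I|]_x g x)%E; first by [].
rewrite ge0_integral_measure_sum// [RHS](reindex (@enum_val I I)) /=; last first.
  exact/onW_bij/enum_val_bij.
apply: eq_bigr => i _; rewrite /atom valK /=.
by rewrite ge0_integral_mscale//= integral_dirac// diracT mul1e.
Qed.

Hypothesis my : forall i, measurable [set y i].

(** The support is a finite union of measurable singletons, so all its subsets are measurable and
    [g] may be arbitrary there. *)
Let measurable_off_atoms (g : T -> \bar R) (c : \bar R) :
  measurable_fun setT (fun x => if x \in range y then g x else c).
Proof.
have fin_m (B : set T) : B `<=` range y -> measurable B.
  move=> By; have fB : finite_set B.
    by apply: sub_finite_set By _; exact/finite_image/finite_finset.
  rewrite (_ : B = \bigcup_(x in B) [set x]); last first.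
    by apply/seteqP; split=> [x Bx|x [z Bz ->]//]; exists x.
  by apply: fin_bigcup_measurable => // x /By [i _ <-].
move=> _ U mU; rewrite setTI.
set D := range y.
rewrite (_ : _ @^-1` U = (D `&` g @^-1` U) `|` (~` D `&` [set _ | U c])).
  apply: measurableU; first by apply: fin_m; exact: subIsetl.
  apply: measurableI; first by apply/measurableC/fin_m.
  have [Uc|Uc] := pselect (U c).
    by rewrite (_ : [set _ | _] = setT) ?measurableT//; apply/seteqP; split.
  by rewrite (_ : [set _ | _] = set0) ?measurable0//; apply/seteqP; split.
apply/seteqP; split=> x /=.
  by case: (boolP (x \in D)) => [/set_mem|/negP Dx] Ux;
    [left|right; split=> // /mem_set].
case: (boolP (x \in D)) => [/set_mem Dx|/negP nDx]; case=> -[] //.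
by move=> /mem_set /nDx.
Qed.

(** Replacing the values off the atoms by 0 or by [+oo] gives two measurable functions that enclose
    the integrand and have the same integral. A possibly non-measurable [g] is thus covered. *)
Lemma ge0_integral_fin_prob (D : set T) (g : T -> \bar R) :
  (forall x, D x -> 0 <= g x)%E -> (forall i, D (y i)) ->
  (\int[P]_(x in D) g x = \sum_i (w i)%:E * g (y i))%E.
Proof.
move=> g0 Dy.
rewrite integral_mkcond; set G := g \_ D.
have G0 x : (0 <= G x)%E.
  by rewrite /G patchE; case: ifPn => // /set_mem; exact: g0.
have Gy i : G (y i) = g (y i) by rewrite /G patchE mem_set.
have ry i : y i \in range y by apply/mem_set; exists i.
pose Gc c x := if x \in range y then G x else c.
(* Monotonicity for non-measurable integrands, read off the supremum over simple functions. *)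
have int_le (g1 g2 : T -> \bar R) : (forall x, 0 <= g1 x)%E ->
    (forall x, g1 x <= g2 x)%E -> (\int[P]_x g1 x <= \int[P]_x g2 x)%E.
  move=> g10 g12; rewrite !ge0_integralTE//; last first.
    by move=> x; exact: le_trans (g12 x).
  apply: le_ereal_sup => _ [h hg1 <-]; exists h => // x.
  exact: le_trans (g12 x).
have intGc (c : \bar R) : (0 <= c)%E ->
    (\int[P]_x Gc c x = \sum_i (w i)%:E * g (y i))%E.
  move=> c0; rewrite ge0_integral_fin_prob_measurable//.
  - by apply: eq_bigr => i _; rewrite /Gc ry Gy.
  - by move=> x; rewrite /Gc; case: ifP.
  - exact: measurable_off_atoms.
apply/eqP; rewrite eq_le; apply/andP; split.
  rewrite -(intGc +oo%E)//; apply: int_le => // x.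
  by rewrite /Gc; case: ifP => // _; rewrite leey.
rewrite -(intGc 0%E)//; apply: int_le => x; rewrite /Gc; case: ifP => //.
Qed.

Lemma integral_fin_prob (g : T -> R) :
  (\int[P]_x (g x)%:E = (\sum_i w i * g (y i))%:E)%E.
Proof.
rewrite integralE !ge0_integral_fin_prob//.
rewrite -[X in (X - _)%E](_ : (\sum_i w i * Num.max (g (y i)) 0)%:E = _)%E;
  last first.
  rewrite -sumEFin; apply: eq_bigr => i _; rewrite funeposE EFinM.
  by rewrite EFin_max.
rewrite -[X in (_ - X)%E](_ : (\sum_i w i * Num.max (- g (y i)) 0)%:E = _)%E;
  last first.
  rewrite -sumEFin; apply: eq_bigr => i _; rewrite funenegE EFinM.
  by rewrite EFin_max.
rewrite -EFinB -sumrB; congr EFin; apply: eq_bigr => i _.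
rewrite -mulrBr; congr (_ * _); rewrite !maxEle oppr_le0.
case: (lerP (g (y i)) 0) => [g_le0|g_gt0]; last by rewrite ltW// subr0.
case: (lerP 0 (g (y i))) => [g_ge0|_]; last by rewrite sub0r opprK.
by rewrite subr0; apply/le_anti; rewrite g_ge0 g_le0.
Qed.

End FiniteProbability.

(** * Two-point bound and Assouad's lemma *)

Lemma sum_prod_ffun (R : comPzSemiRingType) (n : nat) (T : finType)
    (F : 'I_n -> T -> R) :
  \sum_(om : {ffun 'I_n -> T}) \prod_i F i (om i) = \prod_i \sum_t F i t.
Proof. by rewrite bigA_distr_bigA. Qed.

(* [lam] is the likelihood ratio of one observation, [Lam] that of the sample;
   pointwise [min(1, Lam) >= Lam - Lam^2 / 4], so a bound on the second moment
   of [Lam] bounds the testing affinity from below. *)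
Lemma two_point_risk (R : realFieldType) (n : nat) (T : finType)
    (w : 'I_n -> T -> R) (lam : 'I_n -> T -> R)
    (g : {ffun 'I_n -> T} -> R) (a : R) :
  (forall i t, 0 <= w i t) -> (forall i t, 0 <= lam i t) ->
  (forall i, \sum_t w i t * lam i t = 1) ->
  \prod_i \sum_t w i t * lam i t ^+ 2 <= 2 ->
  a ^+ 2 / 4 <= \sum_(om : {ffun 'I_n -> T}) (\prod_i w i (om i)) * g om ^+ 2 +
    \sum_(om : {ffun 'I_n -> T}) (\prod_i (w i (om i) * lam i (om i))) * (g om - a) ^+ 2.
Proof.
move=> w0 lam0 lam1 lam2.
pose W (om : {ffun 'I_n -> T}) := \prod_i w i (om i).
pose Lam (om : {ffun 'I_n -> T}) := \prod_i lam i (om i).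
have W0 om : 0 <= W om by apply: prodr_ge0.
have Lam0 om : 0 <= Lam om by apply: prodr_ge0.
have E1 : \sum_om W om * Lam om = 1.
  under eq_bigr do rewrite /W /Lam -big_split/=.
  by rewrite (sum_prod_ffun (fun i t => w i t * lam i t)) big1.
have E2 : \sum_om W om * Lam om ^+ 2 <= 2.
  under eq_bigr do rewrite /W /Lam -prodrXl -big_split/=.
  by rewrite (sum_prod_ffun (fun i t => w i t * lam i t ^+ 2)).
have -> : \sum_(om : {ffun 'I_n -> T}) (\prod_i (w i (om i) * lam i (om i))) * (g om - a) ^+ 2 =
    \sum_om W om * Lam om * (g om - a) ^+ 2.
  by apply: eq_bigr => om _; rewrite big_split.
rewrite -big_split/=.
(* Summed over [om], the left side is at least [a^2/2 - 2 * a^2/8 = a^2/4]. *)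
have pt om : a ^+ 2 / 2 * (W om * Lam om) - a ^+ 2 / 8 * (W om * Lam om ^+ 2)
    <= W om * g om ^+ 2 + W om * Lam om * (g om - a) ^+ 2.
  rewrite -subr_ge0.
  set l := Lam om; set x := g om.
  suff K : 0 <= x ^+ 2 + l * (x - a) ^+ 2 - (a ^+ 2 / 2 * l - a ^+ 2 / 8 * l ^+ 2).
    have -> : W om * x ^+ 2 + W om * l * (x - a) ^+ 2 -
        (a ^+ 2 / 2 * (W om * l) - a ^+ 2 / 8 * (W om * l ^+ 2)) = W om *
        (x ^+ 2 + l * (x - a) ^+ 2 - (a ^+ 2 / 2 * l - a ^+ 2 / 8 * l ^+ 2)).
      by field.
    exact: mulr_ge0.
  have l0 : 0 <= l := Lam0 om.
  have := sqr_ge0 (x + (x - a)); have := sqr_ge0 (l - 2); move=> l2 x2.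
  have xa : a ^+ 2 / 2 <= x ^+ 2 + (x - a) ^+ 2 by lra.
  have sx : 0 <= x ^+ 2 by exact: sqr_ge0.
  have sy : 0 <= (x - a) ^+ 2 by exact: sqr_ge0.
  have sa : 0 <= a ^+ 2 by exact: sqr_ge0.
  (* The cases follow [min(1, l)]: [l - l^2/4] is at most [l] trivially, and at most 1 because
     [(l - 2)^2 >= 0]. *)
  have [l1|l1] := lerP l 1.
  - have : 0 <= (1 - l) * x ^+ 2 by apply: mulr_ge0 => //; lra.
    have : 0 <= l * (x ^+ 2 + (x - a) ^+ 2 - a ^+ 2 / 2).
      by apply: mulr_ge0 => //; lra.
    have : 0 <= a ^+ 2 * l ^+ 2 by apply: mulr_ge0 => //; exact: sqr_ge0.
    lra.
  - have : 0 <= (l - 1) * (x - a) ^+ 2 by apply: mulr_ge0 => //; lra.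
    have : 0 <= a ^+ 2 * (l - 2) ^+ 2 by apply: mulr_ge0.
    lra.
apply: le_trans (ler_sum _ (fun om _ => pt om)).
rewrite sumrB -!mulr_sumr E1.
have := ler_wpM2l (sqr_ge0 a) E2; lra.
Qed.

Lemma exists_ge_mean (R : realFieldType) (I : finType) (i0 : I) (F : I -> R)
    (c : R) : #|I|%:R * c <= \sum_i F i -> exists i, c <= F i.
Proof.
move=> H; apply: contrapT; move=> /forallNP N.
have : \sum_i F i < \sum_(i : I) c.
  apply: ltr_sum; last by move=> i _; rewrite ltNge; exact/negP.
  by apply/hasP; exists i0 => //; rewrite mem_index_enum.
by rewrite sumr_const -mulr_natl ltNge H.
Qed.

Definition flip M (th : {ffun 'I_M -> bool}) (j : 'I_M) : {ffun 'I_M -> bool} :=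
  [ffun k => (k == j) (+) th k].

Lemma flipK M (j : 'I_M) : involutive (fun th => flip th j).
Proof. by move=> th; apply/ffunP => k; rewrite !ffunE addbA addbb. Qed.

(** Average over the cube: flipping bit [j] is an involution, so each pair of neighbours contributes
    at least [c] and the mean of [F ^~ j] is at least [c / 2]. Some vertex reaches the mean of the
    sum. *)
Lemma assouad (R : realFieldType) M (F : {ffun 'I_M -> bool} -> 'I_M -> R)
    (c : R) :
  (forall (th : {ffun 'I_M -> bool}) (j : 'I_M), ~~ th j -> c <= F th j + F (flip th j) j) ->
  exists th, M%:R * (c / 2) <= \sum_j F th j.
Proof.
move=> Fc; apply: (exists_ge_mean [ffun=> false]).
have Fc' (th : {ffun 'I_M -> bool}) (j : 'I_M) : c <= F th j + F (flip th j) j.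
  have [thj|/Fc //] := boolP (th j).
  rewrite addrC -{2}(flipK j th); apply: Fc.
  by rewrite /flip ffunE eqxx thj.
rewrite exchange_big/=.
have half (j : 'I_M) : #|{ffun 'I_M -> bool}|%:R * (c / 2) <= \sum_th F th j.
  have : \sum_(th : {ffun 'I_M -> bool}) c <=
      \sum_(th : {ffun 'I_M -> bool}) (F th j + F (flip th j) j).
    by apply: ler_sum => th _.
  rewrite big_split/= -[X in _ + X](reindex_inj (inv_inj (flipK j))
    (P := xpredT) (F := F ^~ j)) sumr_const -mulr_natl.
  lra.
apply: (@le_trans _ _ (\sum_(j < M) #|{ffun 'I_M -> bool}|%:R * (c / 2))).
  by rewrite sumr_const card_ord -[leRHS]mulr_natl mulrCA.
by apply: ler_sum => j _; exact: half.
Qed.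

(** * Hoelder bumps *)

(** A ratio in [0,1] only grows when raised to the power [b <= 1]; add this up for [u / (u + v)] and
    [v / (u + v)], whose sum is 1. *)
Lemma powR_subadditive (R : realType) (b u v : R) : 0 < b <= 1 ->
  0 <= u -> 0 <= v -> (u + v) `^ b <= u `^ b + v `^ b.
Proof.
move=> /andP[b0 b1] u0 v0.
have [uv0|uv_neq0] := eqVneq (u + v) 0.
  by rewrite uv0 powR0 ?gt_eqF// addr_ge0// powR_ge0.
have uv_gt0 : 0 < u + v by rewrite lt_neqAle eq_sym uv_neq0 addr_ge0.
have frac s : 0 <= s -> s <= u + v -> s / (u + v) * (u + v) `^ b <= s `^ b.
  move=> s0 suv.
  have -> : s `^ b = (s / (u + v)) `^ b * (u + v) `^ b.
    by rewrite -powRM ?divr_ge0 ?(ltW uv_gt0)// divfK.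
  rewrite ler_wpM2r ?powR_ge0//.
  have [->|s_neq0] := eqVneq s 0; first by rewrite mul0r powR_ge0.
  apply: ger1_powR => //.
  rewrite ler_pdivrMr// mul1r suv andbT divr_gt0// lt_neqAle eq_sym s_neq0.
  exact: s0.
have := lerD (frac u u0 _) (frac v v0 _).
rewrite lerDl lerDr => /(_ v0 u0); apply: le_trans.
by rewrite -!mulrDl divff ?mul1r.
Qed.

(** By subadditivity the power [b] of the distance is again a metric; this is its reverse triangle
    inequality. *)
Lemma powR_dist_hoelder (R : realType) (b x x' c : R) : 0 < b <= 1 ->
  `| `|x - c| `^ b - `|x' - c| `^ b | <= `|x - x'| `^ b.
Proof.
move=> hb; have b0 : 0 <= b by case/andP: hb => /ltW.
have tri (y y' : R) : `|y - c| `^ b <= `|y - y'| `^ b + `|y' - c| `^ b.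
  apply: le_trans (powR_subadditive hb _ _) => //.
  rewrite ge0_ler_powR ?nnegrE ?addr_ge0//.
  by rewrite (_ : y - c = (y - y') + (y' - c)) ?ler_normD//; ring.
have := tri x x'; have := tri x' x; rewrite (distrC x' x) ler_norml; lra.
Qed.

(* Taking the maximum of the bumps, rather than their sum, keeps the Hoelder
   constant [L] of a single bump. *)
Definition bumps (R : realType) (L b h : R) (J : finType) (c : J -> R)
    (th : {ffun J -> bool}) (x : R) : R :=
  \big[Num.max/0]_(j | th j) (L * (h `^ b - `|x - c j| `^ b)).

Section Bumps.
Variables (R : realType) (L b h : R) (J : finType) (c : J -> R).
Hypotheses (L0 : 0 <= L) (hb : 0 < b <= 1) (h0 : 0 <= h).
Variable th : {ffun J -> bool}.
Let f := bumps L b h c th.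

Lemma bumps_hoelder x x' : `|f x - f x'| <= L * `|x - x'| `^ b.
Proof.
rewrite /f /bumps.
elim/big_ind2: _ => [|u1 u2 v1 v2|j _].
- by rewrite subrr normr0 mulr_ge0// powR_ge0.
- rewrite !ler_norml => /andP[? ?] /andP[? ?].
  by rewrite !maxEle; case: ifP; case: ifP;
    move=> /idP; rewrite ?(rwP negP) -?ltNge; lra.
- have -> : L * (h `^ b - `|x - c j| `^ b) - L * (h `^ b - `|x' - c j| `^ b) =
      L * (`|x' - c j| `^ b - `|x - c j| `^ b) by ring.
  by rewrite normrM ger0_norm// ler_wpM2l// distrC powR_dist_hoelder.
Qed.

Let off_bump x j : h <= `|x - c j| -> L * (h `^ b - `|x - c j| `^ b) <= 0.
Proof.
move=> hx; rewrite mulr_ge0_le0// subr_le0 ge0_ler_powR ?nnegrE//.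
by case/andP: hb => /ltW.
Qed.

Lemma bumps_off x : (forall j, h <= `|x - c j|) -> f x = 0.
Proof.
move=> hx; apply/le_anti; rewrite bigmax_ge_id andbT.
by apply: bigmax_le => // j _; exact: off_bump.
Qed.

(** The other bumps are nonpositive at distance [h] or more, so only bump [j] and the base value 0
    of the maximum compete. *)
Lemma bumps_center j : (forall k, k != j -> h <= `|c j - c k|) ->
  f (c j) = (th j)%:R * (L * h `^ b).
Proof.
move=> hx; have a0 : 0 <= L * h `^ b by rewrite mulr_ge0// powR_ge0.
have own : L * (h `^ b - `|c j - c j| `^ b) = L * h `^ b.
  by rewrite subrr normr0 powR0 ?subr0// gt_eqF//; case/andP: hb.
apply/le_anti/andP; split.
  apply: bigmax_le => [|k thk]; first by rewrite mulr_ge0.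
  case: (eqVneq k j) thk => [-> thj|kj _]; first by rewrite own thj mul1r.
  by apply: le_trans (off_bump (hx _ kj)) _; rewrite mulr_ge0.
have [thj|thj] := boolP (th j); last by rewrite mul0r bigmax_ge_id.
by rewrite mul1r -own; exact: (le_bigmax_cond _ (fun k => L * (h `^ b - `|c j - c k| `^ b))).
Qed.

End Bumps.

(** * The design *)

(** Counts the cells met by a ball around centre [j], also when [j] is close to an end of the
    row. *)
Lemma minn_le_count_near (M m j : nat) : (j < M)%N ->
  (minn M m.+1 <= \sum_(k < M) (k <= j + m) && (j <= k + m))%N.
Proof.
move=> jM.
rewrite -(big_mkord xpredT (fun k => ((k <= j + m) && (j <= k + m))%N : nat)).
(* The window [[lo, hi)] contains [j] and has at most [m.+1] elements. It starts at [j] unless it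
   would overrun [M]; truncated subtraction makes it start at 0 when [M <= m.+1]. *)
pose lo := minn j (M - m.+1); pose hi := (lo + minn M m.+1)%N.
have hiM : (hi <= M)%N by rewrite /hi /lo; lia.
have lohi : (lo <= hi)%N by rewrite leq_addr.
rewrite (big_cat_nat (leq0n lo) (leq_trans lohi hiM))/=.
rewrite (big_cat_nat lohi hiM)/= addnCA -[leqLHS]addn0 leq_add//.
rewrite -[leqLHS](_ : \sum_(lo <= k < hi) 1 = _)%N; last first.
  by rewrite sum_nat_const_nat muln1 /hi addKn.
rewrite big_nat [leqRHS]big_nat; apply: leq_sum => k; rewrite /hi /lo; lia.
Qed.

Lemma dist_cells (j k m : nat) (b : bool) :
  (k <= j + m)%N -> (j <= k + m)%N ->
  (`|(2 * j + true)%:Z - (2 * k + b)%:Z| <= 2 * m + 1)%N.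
Proof. case: b; lia. Qed.

Lemma cell_dist_ge1 (j k : nat) (b c : bool) : (j, b) != (k, c) ->
  (1 <= `|(2 * j + b)%:Z - (2 * k + c)%:Z|)%N.
Proof. by rewrite xpair_eqE; case: b; case: c => /=; lia. Qed.

(* The cell [(j, true)] is the centre of the [j]-th bump, [(j, false)] a point
   where all the signals vanish. *)
Section Design.
Context (R : realType) (M : nat).
Variables (h p : R).
Hypotheses (h_gt0 : 0 < h) (Mh : 2 * M%:R * h <= 1).

Local Notation cell := ('I_M * bool)%type.

Definition pt (t : cell) : R := (2 * t.1 + t.2)%:R * h.

Lemma pt_itv t : unit_itv (pt t).
Proof.
rewrite /unit_itv /= in_itv/= /pt mulr_ge0 ?(ltW h_gt0)//=.
apply: le_trans Mh; rewrite -natrM ler_wpM2r ?(ltW h_gt0)// ler_nat.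
by case: t => -[j jM] [] /=; lia.
Qed.

Lemma pt_sep (t t' : cell) : t != t' -> h <= `|pt t - pt t'|.
Proof.
move=> tt'; rewrite /pt -mulrBl normrM (gtr0_norm h_gt0) ler_peMl ?(ltW h_gt0)//.
rewrite !pmulrn -rmorphB/= -intr_norm (ler_int _ 1) -abszE lez_nat.
by apply: cell_dist_ge1; case: t t' tt' => [j b] [k c].
Qed.

Lemma pt_inj : injective pt.
Proof.
move=> t t' E; apply/eqP; apply: contraT => /pt_sep.
by rewrite E subrr normr0 leNgt h_gt0.
Qed.

Lemma dist_pt (t t' : cell) (m : nat) :
  (`|(2 * t.1 + t.2)%:Z - (2 * t'.1 + t'.2)%:Z| <= m)%N ->
  `|pt t - pt t'| <= m%:R * h.
Proof.
move=> mt; rewrite /pt -mulrBl normrM (gtr0_norm h_gt0) ler_wpM2r ?(ltW h_gt0)//.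
rewrite !pmulrn -rmorphB/= -intr_norm.
by rewrite ler_int -abszE lez_nat.
Qed.

Hypotheses (M_gt0 : (0 < M)%N) (p_ge0 : 0 <= p) (pM : p <= M%:R^-1).

(** Each cell has total mass [1/M], as under [wQ], so the mass of a large ball can be counted in
    whole cells. *)
Definition wP (t : cell) : R := if t.2 then p else M%:R^-1 - p.

Definition wQ (t : cell) : R := if t.2 then M%:R^-1 else 0.

Lemma sum_cell (F : cell -> R) :
  \sum_t F t = \sum_j (F (j, true) + F (j, false)).
Proof.
transitivity (\sum_t F (t.1, t.2)); first by apply: eq_bigr => -[].
rewrite -(pair_bigA _ (fun j b => F (j, b)))/=.
by apply: eq_bigr => j _; rewrite big_bool.
Qed.

Lemma wP_ge0 t : 0 <= wP t.
Proof. by rewrite /wP; case: ifP; rewrite ?subr_ge0. Qed.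

Lemma wQ_ge0 t : 0 <= wQ t.
Proof. by rewrite /wQ; case: ifP; rewrite ?invr_ge0. Qed.

Let sum_cst : \sum_(j < M) (M%:R^-1 : R) = 1.
Proof. by rewrite sumr_const card_ord -[LHS]mulr_natl divff// pnatr_eq0 -lt0n. Qed.

Lemma sum_wP : \sum_t wP t = 1.
Proof. by rewrite sum_cell -sum_cst; apply: eq_bigr => j _; rewrite /wP/= subrKC. Qed.

Lemma sum_wQ : \sum_t wQ t = 1.
Proof. by rewrite sum_cell -sum_cst; apply: eq_bigr => j _; rewrite /wQ/= addr0. Qed.

Definition lawP : probability (measurableTypeR R) R :=
  fin_prob (pt : cell -> measurableTypeR R) wP_ge0 sum_wP.

Definition lawQ : probability (measurableTypeR R) R :=
  fin_prob (pt : cell -> measurableTypeR R) wQ_ge0 sum_wQ.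

Lemma lawP_itv : lawP (@unit_itv R) = 1%E.
Proof.
rewrite /lawP fin_probE -sum_wP; congr EFin; apply: eq_bigr => t _.
by rewrite indicE mem_set ?mulr1//; exact: pt_itv.
Qed.

Lemma lawQ_itv : lawQ (@unit_itv R) = 1%E.
Proof.
rewrite /lawQ fin_probE -sum_wQ; congr EFin; apply: eq_bigr => t _.
by rewrite indicE mem_set ?mulr1//; exact: pt_itv.
Qed.

Lemma similarity_le (W : probability (measurableTypeR R) R) (r c : R) : 0 < c ->
  (forall j : 'I_M, c%:E <= W (unit_ball (pt (j, true)) r))%E ->
  (similarity r W lawQ <= (c^-1)%:E)%E.
Proof.
move=> c_gt0 Wc; rewrite /similarity ge0_integral_fin_prob; last 3 first.
- by move=> i; exact: measurable_set1.
- by move=> x _; rewrite inve_ge0.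
- exact: pt_itv.
rewrite -[c^-1]mul1r -sum_wQ mulr_suml -sumEFin.
(* At the zeros the weight vanishes, and [0 * +oo = 0] absorbs a possibly infinite inverse. *)
apply: lee_sum => -[j [|]] _; rewrite /wQ/=; last by rewrite mul0e mul0r.
rewrite EFinM lee_wpmul2l ?lee_fin ?invr_ge0//.
have ci_gt0 : 0 < c^-1 by rewrite invr_gt0.
rewrite inve_ple ?in_itv ?inE/= ?andbT ?lee_fin ?(ltW ci_gt0)//.
by rewrite inver gt_eqF// invrK; exact: Wc.
Qed.

Variable alpha : R.
Hypotheses (alpha_gt0 : 0 < alpha) (hp : p = h `^ alpha).
Hypothesis hM : M = 1%N \/ 1 <= alpha /\ 3 * M%:R * h <= 1.

(** For [r < h] the centre alone has mass [h^alpha]. For [r >= h] the ball contains [minn M m.+1]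
    whole cells: either all of them, or a mass [m.+1 / M >= r >= r^alpha]. *)
Lemma lawP_ball (j : 'I_M) (r : R) : 0 < r <= 1 ->
  ((r `^ alpha)%:E <= lawP (unit_ball (pt (j, true)) r))%E.
Proof.
move=> /andP[r_gt0 r_le1]; rewrite /lawP fin_probE lee_fin.
have ind_ball t : `|pt (j, true) - pt t| <= r ->
    (\1_(unit_ball (pt (j, true)) r) (pt t) : R) = 1.
  by move=> tr; rewrite indicE mem_set//; split => //; exact: pt_itv.
have term_ge0 t : 0 <= wP t * \1_(unit_ball (pt (j, true)) r) (pt t).
  by rewrite mulr_ge0// wP_ge0.
have ra_le1 : r `^ alpha <= 1.
  rewrite -[leRHS](_ : 1 `^ alpha = 1); last by rewrite powR1.
  by rewrite ge0_ler_powR ?nnegrE ?(ltW alpha_gt0) ?(ltW r_gt0).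
have [r_lt_h|h_le_r] := ltP r h.
  rewrite (bigD1 (j, true))// ind_ball ?subrr ?normr0 ?(ltW r_gt0)// mulr1.
  rewrite {1}/wP hp; apply: ler_wpDr; first by apply: sumr_ge0 => t _; exact: term_ge0.
  by rewrite ge0_ler_powR ?nnegrE ?(ltW alpha_gt0) ?(ltW r_gt0) ?(ltW h_gt0) ?(ltW r_lt_h).
have two_h : 0 < 2 * h by rewrite mulr_gt0.
(* The largest [m] with [(2m+1)h <= r]: both points of a cell at index distance at most [m] lie in
   the ball. *)
pose m := Num.trunc ((r - h) / (2 * h)).
have /andP[m_le m_gt] : m%:R <= (r - h) / (2 * h) < m.+1%:R.
  by apply: truncn_itv; rewrite divr_ge0 ?subr_ge0// ltW.
rewrite ler_pdivlMr// in m_le; rewrite ltr_pdivrMr// in m_gt.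
have near_le : (minn M m.+1)%:R / M%:R <=
    \sum_t wP t * \1_(unit_ball (pt (j, true)) r) (pt t).
  rewrite sum_cell.
  apply: (@le_trans _ _ (\sum_(k < M)
      (((k <= j + m) && (j <= k + m))%N)%:R * M%:R^-1)).
    rewrite -mulr_suml -natr_sum ler_wpM2r ?invr_ge0// ler_nat.
    exact: minn_le_count_near.
  apply: ler_sum => k _.
  case: (boolP (_ && _)) => [/andP[kj jk]|_]; last by rewrite mul0r addr_ge0.
  have near b : `|pt (j, true) - pt (k, b)| <= r.
    apply: (@le_trans _ _ ((2 * m + 1)%:R * h)).
      by apply: dist_pt; exact: dist_cells.
    by rewrite natrD natrM; lra.
  by rewrite !ind_ball// !mulr1 mul1r /wP/= subrKC.
apply: le_trans near_le.
have M0 : 0 < M%:R :> R by rewrite ltr0n.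
have [Mm|mM] := leqP M m.+1.
  by rewrite divff ?gt_eqF.
case: hM => [M1|[alpha1 hM3]]; first by move: mM; rewrite M1.
have ra_le : r `^ alpha <= r by rewrite -[leRHS]powRr1 ?(ltW r_gt0)// ger_powR ?r_gt0.
apply: le_trans ra_le _; rewrite ler_pdivlMr//.
have m1 : 1 <= m.+1%:R :> R by rewrite ler1n.
(* From [r < 2h(m+1) + h]; the factor 3 is what [3 * M * h <= 1] compensates. *)
have rm : r <= 3 * h * m.+1%:R.
  have : 0 <= h * (m.+1%:R - 1) by rewrite mulr_ge0 ?subr_ge0// ltW.
  lra.
apply: le_trans (_ : 3 * h * m.+1%:R * M%:R <= _).
  by rewrite ler_wpM2r// ltW.
have : 0 <= m.+1%:R * (1 - 3 * M%:R * h) by rewrite mulr_ge0// subr_ge0.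
lra.
Qed.

Lemma class_D_design (C : R) : 1 <= C -> class_D alpha C lawP lawQ.
Proof.
move=> C1; split; [exact: lawP_itv|exact: lawQ_itv|].
apply: ge_ereal_sup => _ [r /= r01 <-].
have r_gt0 : 0 < r by case/andP: r01.
have ra : 0 < r `^ alpha by rewrite powR_gt0.
apply: (@le_trans _ _ ((r `^ alpha)%:E * ((r `^ alpha)^-1)%:E)%E).
  apply: lee_wpmul2l; first by rewrite lee_fin ltW.
  by apply: similarity_le => // j; exact: lawP_ball.
by rewrite -EFinM mulfV ?gt_eqF// lee_fin.
Qed.

Lemma class_D'_design (C : R) : M = 1%N -> 1 <= C -> class_D' alpha C lawP lawQ.
Proof.
move=> M1 C1; split; first exact: class_D_design.
apply: ge_ereal_sup => _ [r /= /andP[r_gt0 _] <-].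
apply: (@le_trans _ _ (1^-1)%:E); last by rewrite invr1 lee_fin.
(* With a single cell [lawQ] is the point mass at its centre, and every ball around it has mass
   1. *)
apply: similarity_le => // j.
rewrite fin_probE lee_fin -sum_wQ; apply: ler_sum => -[k [|]] _; last first.
  by rewrite /wQ/= mul0r.
rewrite indicE mem_set ?mulr1//; split; first exact: pt_itv.
have -> : k = j.
  by move: k j; rewrite M1 => k j; rewrite (ord1 k) (ord1 j).
by rewrite subrr normr0 ltW.
Qed.

End Design.

(** * The observation model *)

Section FiniteProduct.
Context (R : realType) (n : nat) (T : finType) (t0 : T).
Variable W : 'I_n -> T -> R.
Hypotheses (W_ge0 : forall i t, 0 <= W i t) (W_sum1 : forall i, \sum_t W i t = 1).

Local Notation path := {ffun 'I_n -> T}.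

Definition path_weight (om : path) : R := \prod_i W i (om i).

Lemma path_weight_ge0 om : 0 <= path_weight om.
Proof. exact: prodr_ge0. Qed.

Lemma sum_path_weight : \sum_om path_weight om = 1.
Proof. by rewrite sum_prod_ffun big1. Qed.

(* The paths are encoded in [nat], on which every set is measurable. *)
Definition prod_law : probability nat R :=
  fin_prob (pickle : path -> nat) path_weight_ge0 sum_path_weight.

(** Integers coding no path are read as the constant path [t0]; [prod_law] gives them no mass. *)
Definition coord (i : 'I_n) (w : nat) : T :=
  (odflt [ffun=> t0] (unpickle w) : path) i.

Lemma coord_pickle i (om : path) : coord i (pickle om) = om i.
Proof. by rewrite /coord pickleK. Qed.

Lemma sum_path_weight_prod (G : 'I_n -> T -> R) :
  \sum_(om : path) path_weight om * \prod_i G i (om i) =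
  \prod_i \sum_t W i t * G i t.
Proof.
rewrite -(sum_prod_ffun (fun i t => W i t * G i t)).
by apply: eq_bigr => om _; rewrite big_split.
Qed.

Lemma sum_path_weight_coord (i : 'I_n) (g : T -> R) :
  \sum_(om : path) path_weight om * g (om i) = \sum_t W i t * g t.
Proof.
transitivity (\sum_(om : path) path_weight om *
    \prod_k (if k == i then g (om k) else 1)).
  apply: eq_bigr => om _; rewrite (bigD1 i)//= eqxx big1 ?mulr1// => k.
  by case: eqP.
rewrite (sum_path_weight_prod (fun k t => if k == i then g t else 1)).
rewrite (bigD1 i)//= eqxx [X in _ * X]big1 ?mulr1// => k ki.
by rewrite -[RHS](W_sum1 k) (negbTE ki); apply: eq_bigr => t _; rewrite mulr1.
Qed.

Lemma integral_coord (i : 'I_n) (g : T -> R) :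
  (\int[prod_law]_w (g (coord i w))%:E = (\sum_t W i t * g t)%:E)%E.
Proof.
rewrite integral_fin_prob// -sum_path_weight_coord; congr EFin.
by apply: eq_bigr => om _; rewrite coord_pickle.
Qed.

Lemma prod_law_coord (i : 'I_n) (B : set T) :
  prod_law (coord i @^-1` B) = (\sum_t W i t * \1_B t)%:E.
Proof.
rewrite fin_probE -sum_path_weight_coord; congr EFin; apply: eq_bigr => om _.
by rewrite !indicE; congr (_ * (nat_of_bool _)%:R); apply/idP/idP;
  rewrite !inE/= coord_pickle.
Qed.

(** The indicator of the intersection is a product over all coordinates, with factor 1 outside [J],
    so the sum over paths factorises. *)
Lemma prod_law_indep (J : {set 'I_n}) (B : 'I_n -> set T) :
  (prod_law (\bigcap_(i in [set` J]) (coord i @^-1` B i)) =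
   \prod_(i in J) prod_law (coord i @^-1` B i))%E.
Proof.
rewrite (eq_bigr (fun i => (\sum_t W i t * \1_(B i) t)%:E)); last first.
  by move=> i _; exact: prod_law_coord.
rewrite prodEFin fin_probE; congr EFin.
rewrite [RHS]big_mkcond/=.
transitivity (\sum_(om : path) path_weight om *
    \prod_i (if i \in J then \1_(B i) (om i) else 1)).
  apply: eq_bigr => om _; congr (_ * _); rewrite indicE.
  have [allB|notB] := pselect (forall i, i \in J -> B i (om i)).
    rewrite mem_set; last by move=> i iJ; rewrite /= coord_pickle; exact: allB.
    by rewrite big1// => i _; case: ifPn => // iJ; rewrite indicE mem_set//; exact: allB.
  rewrite memNset; last first.
    by move=> H; apply: notB => i iJ; have := H i iJ; rewrite /= coord_pickle.
  move/existsNP: notB => [i /not_implyP[iJ nB]].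
  by rewrite (bigD1 i)//= iJ indicE memNset// mul0r.
rewrite (sum_path_weight_prod (fun i t => if i \in J then \1_(B i) t else 1)).
apply: eq_bigr => i _; case: ifP => // _.
by rewrite -[RHS](W_sum1 i); apply: eq_bigr => t _; rewrite mulr1.
Qed.

End FiniteProduct.

(** * Noise turning the response into a biased sign *)

Section Noise.
Context (R : realType) (a sigma : R).
Hypotheses (a_ge0 : 0 <= a) (sigma_gt0 : 0 < sigma) (a_sigma : a <= sigma).

Definition sgn (s : bool) : R := if s then 1 else -1.

(* The response is [sgn s * sigma] whatever the signal is: [e] tells whether the
   regression function takes the value [a] or [0] at the covariate. *)
Definition noise_weight (e s : bool) : R := (1 + sgn s * (e%:R * (a / sigma))) / 2.

Definition noise_pt (e s : bool) : R := sgn s * sigma - e%:R * a.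

Lemma noise_weight_ge0 e s : 0 <= noise_weight e s.
Proof.
have t0 : 0 <= a / sigma by rewrite divr_ge0// ltW.
have t1 : a / sigma <= 1 by rewrite ler_pdivrMr// mul1r.
by rewrite divr_ge0// /sgn; case: e; case: s; rewrite ?mul0r ?mul1r; lra.
Qed.

Lemma sum_noise_weight e : \sum_s noise_weight e s = 1.
Proof. by rewrite big_bool /noise_weight /sgn /= mul1r mulN1r; lra. Qed.

Definition noise (e : bool) : probability (measurableTypeR R) R :=
  fin_prob (noise_pt e : bool -> measurableTypeR R) (noise_weight_ge0 e)
    (sum_noise_weight e).

Lemma noise_mean e : (\int[noise e]_x x%:E = 0)%E.
Proof.
rewrite integral_fin_prob; last by move=> i; exact: measurable_set1.
rewrite big_bool /noise_weight /noise_pt /sgn /=; congr EFin.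
by case: e => /=; field; rewrite gt_eqF.
Qed.

(** The response has second moment [sigma^2] and mean [e * a], so the variance is exactly
    [sigma^2 - e * a^2]. *)
Lemma noise_variance e : (\int[noise e]_x (x ^+ 2)%:E <= (sigma ^+ 2)%:E)%E.
Proof.
rewrite integral_fin_prob; last by move=> i; exact: measurable_set1.
rewrite big_bool /noise_weight /noise_pt /sgn /= lee_fin -subr_ge0.
set S := (X in sigma ^+ 2 - X).
have -> : sigma ^+ 2 - S = e%:R * a ^+ 2.
  by rewrite /S; case: e {S} => /=; field; rewrite gt_eqF.
by rewrite mulr_ge0// sqr_ge0.
Qed.

Variable S : set R.
Hypothesis mS : measurable (S : set (measurableTypeR R)).

(** [S] stands for the set of covariates where the signal is active; its measurability is an
    argument so that the kernel structure can be attached. *)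
Definition noise_kernel of measurable (S : set (measurableTypeR R)) :
    measurableTypeR R -> {measure set (measurableTypeR R) -> \bar R} :=
  fun x => noise (x \in S).

Let measurable_noise_kernel U : measurable U ->
  measurable_fun [set: measurableTypeR R] ((noise_kernel mS) ^~ U).
Proof.
move=> mU.
apply: (eq_measurable_fun (fun x : measurableTypeR R =>
  if x \in S then noise true U else noise false U)).
  by move=> x _; rewrite /noise_kernel; case: ifP.
apply: measurable_fun_ifT => //.
apply: (measurable_fun_bool true); rewrite setTI.
rewrite (_ : _ @^-1` _ = S)//; apply/seteqP.
by split=> x /=; [move=> /set_mem|move=> /mem_set].
Qed.

HB.instance Definition _ :=
  isKernel.Build _ _ _ _ _ (noise_kernel mS) measurable_noise_kernel.

Let noise_kernel_prob x : noise_kernel mS x setT = 1%E.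
Proof. exact: probability_setT. Qed.

HB.instance Definition _ :=
  Kernel_isProbability.Build _ _ _ _ _ (noise_kernel mS) noise_kernel_prob.

Lemma noise_kernel_admissible :
  admissible_noise sigma (noise_kernel mS : R.-pker _ ~> _).
Proof. by move=> x _; split; [exact: noise_mean|exact: noise_variance]. Qed.

End Noise.

(** Induction on [(1 + x)(1 - x - S) <= 1 - S]. When the sum is at most 1/2, the product is at most
    2. *)
Lemma prod_1D_le (R : realFieldType) (I : Type) (r : seq I) (x : I -> R) :
  (forall i, 0 <= x i) ->
  (\prod_(i <- r) (1 + x i)) * (1 - \sum_(i <- r) x i) <= 1.
Proof.
move=> x0; elim: r => [|i r IH]; first by rewrite !big_nil subr0 mulr1.
rewrite !big_cons; apply: le_trans IH.
set Q := \prod_(_ <- _) _; set S := \sum_(_ <- _) _.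
have Q0 : 0 <= Q by apply: prodr_ge0 => k _; rewrite addr_ge0.
have S0 : 0 <= S by apply: sumr_ge0.
rewrite -subr_ge0 [leRHS](_ : _ = Q * (x i * S + x i * x i)); last by ring.
by rewrite mulr_ge0// addr_ge0// mulr_ge0.
Qed.

(** * Lower bound for a fixed design and bandwidth *)

Section LowerBound.
Context (R : realType) (L beta L' h p sigma : R) (M nP nQ : nat).
Hypotheses (hb : 0 < beta <= 1) (L'_ge0 : 0 <= L') (L'_le : L' <= L).
Hypotheses (M_gt0 : (0 < M)%N) (h_gt0 : 0 < h) (Mh : 2 * M%:R * h <= 1).
Hypotheses (p_ge0 : 0 <= p) (pM : p <= M%:R^-1) (sigma_gt0 : 0 < sigma).

Let a := L' * h `^ beta.
Hypothesis a_sigma : a <= sigma.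
Hypothesis info : (nP%:R * p + nQ%:R * M%:R^-1) * (a / sigma) ^+ 2 <= 1 / 2.

Let n := (nP + nQ)%N.
Let P := lawP h M_gt0 p_ge0 pM.
Let Q : probability (measurableTypeR R) R := lawQ h M_gt0.
Let a_ge0 : 0 <= a. Proof. by rewrite mulr_ge0// powR_ge0. Qed.

Local Notation cell := ('I_M * bool)%type.
Local Notation obs := (cell * bool)%type.
Local Notation cube := {ffun 'I_M -> bool}.
Local Notation site := (@pt R M h).

Let signal (th : cube) : R -> R := bumps L' beta h (fun j => site (j, true)) th.
Let active (th : cube) (t : cell) : bool := t.2 && th t.1.

Let signal_pt th t : signal th (site t) = (active th t)%:R * a.
Proof.
case: t => j [|]; rewrite /active/=.
  apply: (@bumps_center _ _ _ _ _ (fun j => site (j, true))) => //; first exact: ltW.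
  by move=> k kj; apply: pt_sep => //; rewrite xpair_eqE eq_sym (negbTE kj).
rewrite mul0r; apply: bumps_off => //; first exact: ltW.
by move=> k; apply: pt_sep => //; rewrite xpair_eqE andbF.
Qed.

Let signal_hoelder th : hoelder_class beta L (signal th).
Proof.
split=> [x x' _ _|].
  apply: le_trans (bumps_hoelder _ _ _ _ _ _ _) _ => //.
  by rewrite ler_wpM2r// powR_ge0.
rewrite -[X in signal _ X](_ : site (Ordinal M_gt0, false) = 0).
  by rewrite signal_pt mul0r.
by rewrite /pt/= mul0r.
Qed.

Let S (th : cube) : set R := [set x | exists2 j, th j & x = site (j, true)].

Let mS th : measurable (S th : set (measurableTypeR R)).
Proof.
rewrite (_ : S th = \bigcup_(j in [set j : 'I_M | th j]) [set site (j, true)]); last first.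
  by apply/seteqP; split=> x /= [j thj ->]; exists j.
by apply: fin_bigcup_measurable => // j _; exact: measurable_set1.
Qed.

Let pt_S th t : (site t \in S th) = active th t.
Proof.
rewrite /active; apply/idP/idP => [/set_mem[j thj /(pt_inj h_gt0) ->] //|].
by case: t => j [] //= thj; apply/mem_set; exists j.
Qed.

Let cov_weight (i : 'I_n) (t : cell) : R :=
  if (i < nP)%N then wP p t else wQ R t.

Let cov_weight_ge0 i t : 0 <= cov_weight i t.
Proof. by rewrite /cov_weight; case: ifP; rewrite ?wP_ge0 ?wQ_ge0. Qed.

Let sum_cov_weight i : \sum_t cov_weight i t = 1.
Proof. by rewrite /cov_weight; case: (i < nP)%N; [exact: sum_wP|exact: sum_wQ]. Qed.

Let W (th : cube) (i : 'I_n) (t : obs) : R :=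
  cov_weight i t.1 * noise_weight a sigma (active th t.1) t.2.

Let W_ge0 th i t : 0 <= W th i t.
Proof. by rewrite mulr_ge0// noise_weight_ge0. Qed.

Let sum_obs (F : cell -> bool -> R) :
  \sum_(t : obs) F t.1 t.2 = \sum_c \sum_s F c s.
Proof. by rewrite -(pair_bigA _ F). Qed.

Let W_sum1 th i : \sum_t W th i t = 1.
Proof.
rewrite (sum_obs (fun c s => cov_weight i c * noise_weight a sigma (active th c) s)).
rewrite -(sum_cov_weight i); apply: eq_bigr => c _.
by rewrite -mulr_sumr sum_noise_weight mulr1.
Qed.

Let t0 : obs := (Ordinal M_gt0, true, true).
Let Pr th : probability nat R := prod_law (W_ge0 th) (W_sum1 th).
Let co (i : 'I_n) : nat -> obs := coord t0 i.

Let covariate (i : 'I_n) (w : nat) : measurableTypeR R := site (co i w).1.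
Let disturbance (th : cube) (i : 'I_n) (w : nat) : measurableTypeR R :=
  noise_pt a sigma (active th (co i w).1) (co i w).2.

Let m_covariate i : measurable_fun setT (covariate i). Proof. by []. Qed.
Let m_disturbance th i : measurable_fun setT (disturbance th i). Proof. by []. Qed.

Let X th (i : 'I_n) : {RV (Pr th) >-> measurableTypeR R} :=
  mfun_Sub (mem_set (m_covariate i)).
Let xi th (i : 'I_n) : {RV (Pr th) >-> measurableTypeR R} :=
  mfun_Sub (mem_set (m_disturbance th i)).

Let response_coord th i w :
  response (signal th) (X th) (xi th) i w = sgn R (co i w).2 * sigma.
Proof.
rewrite /response; change (signal th (site (co i w).1) +
  noise_pt a sigma (active th (co i w).1) (co i w).2 = sgn R (co i w).2 * sigma).
by rewrite signal_pt /noise_pt subrKC.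
Qed.

Let kernel th : R.-pker (measurableTypeR R) ~> (measurableTypeR R) :=
  noise_kernel a_ge0 sigma_gt0 a_sigma (mS th).

Let observations th :
  observation_model P Q (signal th) (kernel th) (X th) (xi th).
Proof.
split.
- by move=> i w; exact: (pt_itv h_gt0 Mh (co i w).1).
- move=> i A mA.
  transitivity (Pr th (co i @^-1` [set t | A (site t.1)])); first by [].
  rewrite prod_law_coord.
  rewrite (sum_obs (fun c s => cov_weight i c *
    noise_weight a sigma (active th c) s * \1_[set t : obs | A (site t.1)] (c, s))).
  transitivity ((\sum_c cov_weight i c * \1_A (site c))%:E).
    congr EFin; apply: eq_bigr => c _.
    rewrite -[RHS]mul1r -(sum_noise_weight a sigma (active th c)) mulr_suml.
    by apply: eq_bigr => s _; rewrite -mulrA mulrCA.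
  by rewrite /cov_weight; case: (i < nP)%N; rewrite fin_probE.
- move=> i A B mA mB.
  transitivity (Pr th (co i @^-1` [set t | A (site t.1) /\
    B (noise_pt a sigma (active th t.1) t.2)])); first by [].
  rewrite prod_law_coord.
  (* [g c] is the indicator of [A] times the conditional probability of [B] given the cell; both
     sides are its mean. *)
  pose g (c : cell) : R := \1_A (site c) *
    \sum_s noise_weight a sigma (active th c) s *
      \1_B (noise_pt a sigma (active th c) s).
  transitivity (\int[Pr th]_w (g (co i w).1)%:E)%E; last first.
    rewrite [RHS]integral_mkcond; apply: eq_integral => w _.
    rewrite patchE /g indicE /=.
    have -> : (w \in X th i @^-1` A) = (site (co i w).1 \in A).
      by apply/idP/idP; rewrite !inE.
    case: ifP => _; last by rewrite mul0r.
    rewrite mul1r -[RHS](_ : noise a_ge0 sigma_gt0 a_sigma (active th (co i w).1) B = _).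
      by rewrite fin_probE.
    by rewrite /kernel /noise_kernel -pt_S.
  rewrite (integral_coord _ _ _ i (fun t => g t.1)); congr EFin.
  rewrite (sum_obs (fun c s => cov_weight i c * noise_weight a sigma (active th c) s *
    \1_[set t : obs | A (site t.1) /\ B (noise_pt a sigma (active th t.1) t.2)] (c, s))).
  rewrite (sum_obs (fun c s => cov_weight i c * noise_weight a sigma (active th c) s *
    g c)).
  apply: eq_bigr => c _.
  under [RHS]eq_bigr do rewrite mulrAC.
  rewrite -mulr_sumr sum_noise_weight mulr1 /g mulr_sumr mulr_sumr.
  apply: eq_bigr => s _; move: (noise_weight _ _ _ s) => nw.
  rewrite -mulrA; congr (_ * _); rewrite [RHS]mulrCA; congr (_ * _); rewrite !indicE -natrM mulnb.
  congr (nat_of_bool _)%:R; apply/idP/idP.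
    by rewrite inE/= => -[? ?]; rewrite !mem_set.
  by move=> /andP[/set_mem ? /set_mem ?]; rewrite inE.
- move=> J A mA.
  (* The response being a function of the sign, the event on pair [i] depends on coordinate [i] of
     the path only. *)
  pose B i : set obs := [set t | A i (site t.1, sgn R t.2 * sigma)].
  have E i : (fun w => (X th i w, response (signal th) (X th) (xi th) i w)) @^-1` A i
      = co i @^-1` B i.
    by apply/funext => w; rewrite /preimage/= response_coord.
  rewrite (eq_bigcapr (fun i _ => E i)).
  by under [RHS]eq_bigr do rewrite E; exact: prod_law_indep.
Qed.

(** Independent of [th]: the hypotheses differ only in the weights of the paths, which makes their
    likelihood ratio explicit. *)
Let data (om : {ffun 'I_n -> obs}) :
    n.-tuple (measurableTypeR R * measurableTypeR R) :=
  [tuple (site (om i).1 : measurableTypeR R,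
          sgn R (om i).2 * sigma : measurableTypeR R) | i < n].

Let sample_data th om :
  sample (X th) (response (signal th) (X th) (xi th)) (pickle om) = data om.
Proof.
apply: eq_from_tnth => i; rewrite !tnth_mktuple response_coord.
by rewrite /co !coord_pickle; congr (_, _);
  rewrite /=/covariate/co coord_pickle.
Qed.

Let sq_loss_design (g f : R -> R) :
  sq_loss Q g f = (\sum_j M%:R^-1 * (g (site (j, true)) - f (site (j, true))) ^+ 2)%:E.
Proof.
rewrite /sq_loss ge0_integral_fin_prob; first last.
- by move=> t; exact: (pt_itv h_gt0 Mh).
- by move=> x _; rewrite lee_fin sqr_ge0.
- by move=> t; exact: measurable_set1.
under eq_bigr do rewrite -EFinM.
rewrite sumEFin sum_cell; congr EFin; apply: eq_bigr => j _.
by rewrite /wQ/= mul0r addr0.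
Qed.

(** The risk splits into one term per bump, as Assouad's argument requires. *)
Let risk_design th fhat :
  (\int[Pr th]_w sq_loss Q
     (fhat (sample (X th) (response (signal th) (X th) (xi th)) w)) (signal th) =
   (\sum_j M%:R^-1 * \sum_om path_weight (W th) om *
      (fhat (data om) (site (j, true)) - (th j)%:R * a) ^+ 2)%:E)%E.
Proof.
under eq_integral do rewrite sq_loss_design.
rewrite integral_fin_prob//; congr EFin.
under [RHS]eq_bigr do rewrite mulr_sumr.
rewrite exchange_big/=; apply: eq_bigr => om _.
rewrite mulr_sumr; apply: eq_bigr => j _.
by rewrite mulrCA sample_data signal_pt.
Qed.

(** Likelihood ratio of one observation when bump [j] is switched on; it differs from 1 only at
    centre [j]. *)
Let lam (j : 'I_M) (i : 'I_n) (t : obs) : R :=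
  if t.1 == (j, true) then 1 + sgn R t.2 * (a / sigma) else 1.

Let W_flip (th : cube) (j : 'I_M) i t : ~~ th j ->
  W (flip th j) i t = W th i t * lam j i t.
Proof.
case: t => -[k b] s thj; rewrite /W /lam /active /flip !ffunE/= -mulrA.
congr (_ * _); rewrite xpair_eqE /noise_weight.
have [->|kj] := eqVneq k j; last by rewrite addFb/= mulr1.
case: b => /=; last by rewrite mulr1.
by rewrite (negbTE thj)/=; move: (a / sigma) => u; field.
Qed.

(** With bump [j] off, the sign at centre [j] is a fair coin, and [1 + t] or [1 - t] squared
    averages to [1 + t^2]. *)
Let lam_second_moment (th : cube) (j : 'I_M) i : ~~ th j ->
  \sum_t W th i t * lam j i t ^+ 2 = 1 + cov_weight i (j, true) * (a / sigma) ^+ 2.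
Proof.
move=> thj.
rewrite (sum_obs (fun c s => cov_weight i c * noise_weight a sigma (active th c) s *
  lam j i (c, s) ^+ 2)).
transitivity (\sum_c (cov_weight i c +
    (if c == (j, true) then cov_weight i c * (a / sigma) ^+ 2 else 0))).
  apply: eq_bigr => c _; rewrite big_bool /lam/=.
  case: eqP => [->|_]; last first.
    rewrite addr0 expr1n !mulr1 -mulrDr.
    have := sum_noise_weight a sigma (active th c).
    by rewrite big_bool => ->; rewrite mulr1.
  rewrite /active/= (negbTE thj) /noise_weight /sgn/=.
  by move: (a / sigma) (cov_weight _ _) => u v; field.
rewrite big_split/= sum_cov_weight -big_mkcond/=.
by rewrite (big_pred1 (j, true)).
Qed.

Let sum_cov_weight_center j :
  \sum_(i < n) cov_weight i (j, true) = nP%:R * p + nQ%:R * M%:R^-1.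
Proof.
rewrite /cov_weight big_split_ord/=; congr (_ + _).
  under eq_bigr do rewrite ltn_ord /wP/=.
  by rewrite sumr_const card_ord [RHS]mulr_natl.
under eq_bigr do rewrite ltnNge leq_addr /wQ/=.
by rewrite sumr_const card_ord [RHS]mulr_natl.
Qed.

Let lam_moment_le2 (th : cube) (j : 'I_M) : ~~ th j ->
  \prod_i \sum_t W th i t * lam j i t ^+ 2 <= 2.
Proof.
move=> thj; under eq_bigr do rewrite lam_second_moment//.
have x0 (i : 'I_n) : 0 <= cov_weight i (j, true) * (a / sigma) ^+ 2.
  by rewrite mulr_ge0// sqr_ge0.
have := prod_1D_le (index_enum 'I_n) x0.
rewrite -mulr_suml sum_cov_weight_center.
set Q0 := \prod_(_ <- _) _; set s := _ * _ ^+ 2 => H.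
have Q0_ge0 : 0 <= Q0 by apply: prodr_ge0 => i _; rewrite addr_ge0.
have : 0 <= Q0 * (1 / 2 - s) by rewrite mulr_ge0// subr_ge0.
lra.
Qed.

(** Each bump costs [a^2/4] over its two states, Assouad's average halves this, and the [M] bumps
    have weight [1/M] each. *)
Lemma minimax_risk_ge : ((a ^+ 2 / 8)%:E <= minimax_risk beta L sigma nP nQ P Q)%E.
Proof.
apply: le_ereal_inf_tmp => _ [fhat _ <-].
pose F (th : cube) j : R := \sum_om path_weight (W th) om *
  (fhat (data om) (site (j, true)) - (th j)%:R * a) ^+ 2.
have [th thF] : exists th, M%:R * (a ^+ 2 / 4 / 2) <= \sum_j F th j.
  apply: assouad => th j thj.
  apply: le_trans (two_point_risk (lam := lam j)
    (fun om => fhat (data om) (site (j, true))) a (W_ge0 th) _ _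
    (lam_moment_le2 thj)) _.
  - move=> i t; rewrite /lam; case: ifP => // _.
    have t1 : a / sigma <= 1 by rewrite ler_pdivrMr// mul1r.
    have t0' : 0 <= a / sigma by rewrite divr_ge0// ltW.
    by rewrite /sgn; case: t.2; rewrite ?mul1r ?mulN1r; lra.
  - by move=> i; rewrite -(W_sum1 (flip th j) i); apply: eq_bigr => t _; rewrite W_flip.
  rewrite /F ffunE eqxx (negbTE thj)/= mul0r mul1r lerD//.
    by apply: ler_sum => om _; rewrite subr0.
  apply: ler_sum => om _.
  rewrite [path_weight (W (flip th j)) om](_ : _ =
    \prod_i (W th i (om i) * lam j i (om i)))//.
  by apply: eq_bigr => i _; exact: W_flip.
apply: le_trans (_ : (_ <= (\sum_j M%:R^-1 * F th j)%:E)%E) _.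
  rewrite lee_fin -mulr_sumr -ler_pdivrMl ?invr_gt0 ?ltr0n// invrK.
  by apply: le_trans thF; rewrite ler_wpM2l//; lra.
rewrite -risk_design; apply: ereal_sup_ubound.
exists (signal th), (kernel th), _, nat, (Pr th), (X th), (xi th).
by split=> //; exact: noise_kernel_admissible.
Qed.

End LowerBound.

(** * Choice of the bandwidth *)

(** [K <= L] keeps the signals in the Hoelder class; [K <= 1/4] keeps the amplitude below [sigma]
    and the information below 1/2. *)
Lemma design_lower_bound (R : realType) (L beta alpha C sigma h : R)
    (M nP nQ : nat) (K := Num.min L 4^-1) :
  0 < L -> 0 < beta <= 1 -> 0 < alpha -> 1 <= C -> 0 < sigma ->
  (0 < M)%N -> 0 < h -> 2 * M%:R * h <= 1 -> h `^ alpha <= M%:R^-1 ->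
  M = 1%N \/ 1 <= alpha /\ 3 * M%:R * h <= 1 ->
  h `^ beta <= sigma ->
  nP%:R / sigma ^+ 2 * h `^ (2 * beta + alpha) <= 1 ->
  nQ%:R / sigma ^+ 2 * h `^ (2 * beta) <= 6 * M%:R ->
  exists P Q : probability (measurableTypeR R) R,
    [/\ class_D alpha C P Q, M = 1%N -> class_D' alpha C P Q &
      ((K ^+ 2 / 8 * h `^ (2 * beta))%:E <= minimax_risk beta L sigma nP nQ P Q)%E].
Proof.
move=> L0 hb alpha0 C1 sigma0 M0 h0 Mh pM hM hsig infoP infoQ.
have K0 : 0 <= K by rewrite le_min ltW//= invr_ge0.
have KL : K <= L by rewrite ge_min lexx.
have K4 : K <= 4^-1 by rewrite ge_min lexx orbT.
move: K K0 KL K4 => {}K K0 KL K4.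
have hb2 : h `^ (2 * beta) = (h `^ beta) ^+ 2 by rewrite mulrC powRrM powR_mulrn ?powR_ge0.
have hb0 : 0 <= h `^ beta := powR_ge0 _ _.
have Ksigma : K * h `^ beta <= sigma.
  apply: le_trans hsig; rewrite ger_pMl ?powR_gt0//; lra.
have info : (nP%:R * h `^ alpha + nQ%:R * M%:R^-1) * (K * h `^ beta / sigma) ^+ 2
    <= 1 / 2.
  have -> : (nP%:R * h `^ alpha + nQ%:R * M%:R^-1) * (K * h `^ beta / sigma) ^+ 2 =
      K ^+ 2 * (nP%:R / sigma ^+ 2 * (h `^ (2 * beta) * h `^ alpha) +
                nQ%:R / sigma ^+ 2 * h `^ (2 * beta) / M%:R).
    by rewrite hb2; field; rewrite !gt_eqF ?ltr0n.
  rewrite -powRD; last by rewrite (gt_eqF h0) implybT.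
  have K2 : K ^+ 2 <= 4^-1 ^+ 2 by rewrite ler_pXn2r ?nnegrE ?invr_ge0.
  have infoQ' : nQ%:R / sigma ^+ 2 * h `^ (2 * beta) / M%:R <= 6.
    by rewrite ler_pdivrMr ?ltr0n.
  have K20 : 0 <= K ^+ 2 by exact: sqr_ge0.
  (* The [P] sample contributes at most 1 and the [Q] sample at most 6, and [7/16 <= 1/2]. *)
  apply: (@le_trans _ _ (K ^+ 2 * 7)); last lra.
  by apply: ler_wpM2l => //; lra.
exists (lawP h M0 (powR_ge0 h alpha) pM), (lawQ h M0); split.
- exact: class_D_design.
- by move=> M1; exact: class_D'_design.
- apply: le_trans (minimax_risk_ge hb K0 KL M0 h0 Mh (powR_ge0 h alpha) pM
    sigma0 Ksigma info).
  by rewrite lee_fin hb2 exprMn mulrAC.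
Qed.

Lemma large_sample (R : realType) (sigma g U : R) : 0 < sigma -> 0 < g -> 0 < U ->
  exists n0 : nat, forall nP nQ : nat, (n0 <= maxn nP nQ)%N ->
    U <= (nP%:R / sigma ^+ 2) `^ g + nQ%:R / sigma ^+ 2.
Proof.
move=> sigma0 g0 U0; have s2 : 0 < sigma ^+ 2 by rewrite exprn_gt0.
(* Either sample may be the large one: [U] is the threshold for the linear term, [U^(1/g)] for the
   power. *)
pose B := Num.max U (U `^ g^-1).
exists (Num.trunc (B * sigma ^+ 2)).+1 => nP nQ hn.
have BU : U <= B by rewrite le_max lexx.
have BUg : U `^ g^-1 <= B by rewrite le_max lexx orbT.
have large k : (Num.trunc (B * sigma ^+ 2) < k)%N -> B <= k%:R / sigma ^+ 2.
  move=> hk; rewrite ler_pdivlMr//.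
  by apply: ltW; apply: lt_le_trans (truncnS_gt _) _; rewrite ler_nat.
move: hn; rewrite leq_max => /orP[] /large hk.
  apply: ler_wpDr; first by rewrite divr_ge0// ltW.
  rewrite -[leLHS](_ : (U `^ g^-1) `^ g = U); last first.
    by rewrite -powRrM mulVf ?gt_eqF// powRr1 ?ltW.
  rewrite ge0_ler_powR ?nnegrE ?powR_ge0 ?divr_ge0 ?(ltW g0) ?(ltW s2)//.
  exact: le_trans BUg hk.
by apply: ler_wpDl; [exact: powR_ge0|exact: le_trans BU hk].
Qed.

(* The bandwidth solves [max (x h^e) (y h^nu) ~ 1]. *)
Lemma bandwidth (R : realType) (x y nu e eta : R)
    (u := x `^ (nu / e) + y) (h := u `^ (- nu^-1)) :
  0 <= x -> 0 <= y -> 0 < nu -> 0 < e -> 0 < eta -> eta `^ (- nu) <= u ->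
  [/\ 0 < h, h <= eta, x * h `^ e <= 1 & y * h `^ nu <= 1] /\
  forall q, h `^ q = u `^ (- (q / nu)).
Proof.
move=> x0 y0 nu0 e0 eta0 etau.
have u0 : 0 < u by apply: lt_le_trans etau; rewrite powR_gt0.
have hq q : h `^ q = u `^ (- (q / nu)).
  by rewrite /h -powRrM mulNr mulrC.
have hnu : h `^ nu = u^-1.
  by rewrite hq divff ?gt_eqF// powRN powRr1 ?ltW.
split=> //; split; first by rewrite powR_gt0.
- have -> : eta = (eta `^ (- nu)) `^ (- nu^-1).
    by rewrite -powRrM mulrNN divff ?gt_eqF// powRr1 ?ltW.
  rewrite /h !powRN lef_pV2 ?posrE ?powR_gt0 ?invr_gt0 ?powR_gt0//.
  by rewrite ge0_ler_powR ?nnegrE ?invr_ge0 ?powR_ge0 ?(ltW nu0) ?(ltW u0) -?powRN.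
- have -> : x = (x `^ (nu / e)) `^ (e / nu).
    by rewrite -powRrM mulrA divfK ?gt_eqF// divff ?gt_eqF// powRr1.
  rewrite hq powRN ler_pdivrMr ?powR_gt0// mul1r.
  rewrite ge0_ler_powR ?nnegrE ?powR_ge0 ?(ltW u0) ?divr_ge0 ?(ltW e0) ?(ltW nu0)//.
  by rewrite lerDl.
- by rewrite hnu ler_pdivrMr// mul1r lerDr powR_ge0.
Qed.

Theorem theorem2 (R : realType) (L beta alpha C : R)
  (hL : 0 < L) (hbeta : 0 < beta <= 1) (halpha : 0 < alpha) (hC : 1 <= C) :
  exists c : R, 0 < c /\
    forall sigma : R, 0 < sigma ->
    exists n0 : nat,
    forall nP nQ : nat, (n0 <= maxn nP nQ)%N ->
      (1 < alpha ->
        exists P Q : probability (measurableTypeR R) R,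
          class_D alpha C P Q /\
          ((c * ((nP%:R / sigma ^+ 2) `^ ((2 * beta + 1) / (2 * beta + alpha))
                 + nQ%:R / sigma ^+ 2) `^ (- (2 * beta / (2 * beta + 1))))%:E
           <= minimax_risk beta L sigma nP nQ P Q)%E) /\
      (alpha <= 1 ->
        exists P Q : probability (measurableTypeR R) R,
          class_D' alpha C P Q /\
          ((c * ((nP%:R / sigma ^+ 2) `^ (2 * beta / (2 * beta + alpha))
                 + nQ%:R / sigma ^+ 2)^-1)%:E
           <= minimax_risk beta L sigma nP nQ P Q)%E).
Proof.
have [beta0 beta1] := andP hbeta.
pose K := Num.min L 4^-1.
have K0 : 0 < K by rewrite lt_min hL invr_gt0 ltr0n.
exists (K ^+ 2 / 8); split; first by rewrite divr_gt0// exprn_gt0.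
move=> sigma sigma0.
(* The bound 1/6 makes room for at least one cell; the other one gives [h^beta <= sigma]. *)
pose eta := Num.min 6^-1 (sigma `^ beta^-1).
have eta0 : 0 < eta by rewrite lt_min powR_gt0// andbT invr_gt0 ltr0n.
have e0 : 0 < 2 * beta + alpha by lra.
have threshold (nu : R) : 0 < nu -> exists n0 : nat, forall nP nQ : nat,
    (n0 <= maxn nP nQ)%N -> eta `^ (- nu) <=
    (nP%:R / sigma ^+ 2) `^ (nu / (2 * beta + alpha)) + nQ%:R / sigma ^+ 2.
  by move=> nu0; apply: large_sample => //; rewrite ?divr_gt0 ?powR_gt0.
have small h : 0 < h -> h <= eta -> h <= 6^-1 /\ h `^ beta <= sigma.
  rewrite le_min => h0 /andP[h6 hs]; split=> //.
  rewrite -[leRHS](_ : (sigma `^ beta^-1) `^ beta = _); last first.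
    by rewrite -powRrM mulVf ?gt_eqF// powRr1 ?ltW.
  by rewrite ge0_ler_powR ?nnegrE ?powR_ge0 ?(ltW h0) ?(ltW beta0).
have x0 (k : nat) : 0 <= k%:R / sigma ^+ 2 by rewrite divr_ge0 ?sqr_ge0.
have nua0 : 0 < 2 * beta + 1 by lra.
have nub0 : 0 < 2 * beta by lra.
have [na Ha] := threshold _ nua0; have [nb Hb] := threshold _ nub0.
exists (maxn na nb) => nP nQ; rewrite geq_max => /andP[/Ha {}Ha /Hb {}Hb].
split=> halpha'.
- have [[h0 heta infoP infoQ] hq] := bandwidth (x0 nP) (x0 nQ) nua0 e0 eta0 Ha.
  set h := (X in 0 < X) in h0 heta infoP infoQ hq *.
  have [h6 hsig] := small h h0 heta.
  (* The largest number of cells with [3 * M * h <= 1]. *)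
  pose M := Num.trunc (3 * h)^-1.
  have h3 : 0 < 3 * h by lra.
  have /andP[M_le M_gt] : M%:R <= (3 * h)^-1 < M.+1%:R.
    by apply: truncn_itv; rewrite invr_ge0 ltW.
  have M0 : (0 < M)%N.
    by rewrite truncn_gt0 invf_ge1//; lra.
  have M1 : 1 <= M%:R :> R by rewrite ler1n.
  have Mh3 : M%:R * (3 * h) <= 1 by rewrite -ler_pdivlMr// div1r.
  (* Truncation loses at most a factor 2: [1 < 3(M+1)h <= 6Mh]. *)
  have Mh6 : 1 <= 6 * M%:R * h.
    have : 1 < M.+1%:R * (3 * h) by rewrite -ltr_pdivrMr// div1r.
    rewrite -natr1 => H; have : 0 <= (M%:R - 1) * h by rewrite mulr_ge0 ?subr_ge0// ltW.
    lra.
  have hM : h `^ alpha <= M%:R^-1.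
    apply: (@le_trans _ _ h).
      rewrite -[leRHS](powRr1 (ltW h0)) ger_powR ?(ltW halpha')// h0/=; lra.
    rewrite -[leRHS]div1r ler_pdivlMr ?ltr0n//.
    have : 0 <= M%:R * h by rewrite mulr_ge0// ltW.
    lra.
  (* The bandwidth controls [h^(2 beta + 1)]; dividing by [h] leaves [1/h <= 6M], the [Q] mass being
     spread over [M] centres. *)
  have infoQ' : nQ%:R / sigma ^+ 2 * h `^ (2 * beta) <= 6 * M%:R.
    move: infoQ; rewrite powRD; last by rewrite gt_eqF ?implybT.
    rewrite (powRr1 (ltW h0)) mulrA => infoQ.
    rewrite -(ler_pM2r h0); exact: le_trans infoQ Mh6.
  have Mh2 : 2 * M%:R * h <= 1.
    have : 0 <= M%:R * h by rewrite mulr_ge0// ltW.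
    lra.
  have [|P [Q [PQ _ risk]]] := design_lower_bound hL hbeta halpha hC sigma0 M0 h0
    Mh2 hM _ hsig infoP infoQ'.
    by right; split; [exact: ltW|rewrite -mulrA mulrCA].
  exists P, Q; split=> //.
  by rewrite -hq.
- have [[h0 heta infoP infoQ] hq] := bandwidth (x0 nP) (x0 nQ) nub0 e0 eta0 Hb.
  set h := (X in 0 < X) in h0 heta infoP infoQ hq *.
  have [h6 hsig] := small h h0 heta.
  have h2 : 2 * 1%:R * h <= 1 by lra.
  have ha : h `^ alpha <= 1%:R^-1.
    rewrite invr1 -[leRHS](_ : 1 `^ alpha = 1); last by rewrite powR1.
    by rewrite ge0_ler_powR ?nnegrE ?(ltW halpha) ?(ltW h0)//; lra.
  have infoQ' : nQ%:R / sigma ^+ 2 * h `^ (2 * beta) <= 6 * 1%:R by lra.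
  have [P [Q [_ /(_ erefl) PQ risk]]] := design_lower_bound hL hbeta halpha hC sigma0
    (ltn0Sn 0) h0 h2 ha (or_introl erefl) hsig infoP infoQ'.
  exists P, Q; split=> //.
  (* With [nu = 2 beta] the exponent in [hq] is -1. *)
  apply: le_trans risk; rewrite lee_fin hq divff ?gt_eqF// powRN powRr1//.
  by rewrite addr_ge0// powR_ge0.
Qed.
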